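(* Let $X$ be a barrelled topological sequence space (over $\mathbb{K}=\mathbb{R}$ or $\mathbb{C}$) in which $(e_n)_{n=1}^{\infty}$ forms a basis. Let $\nu=(v_n)_{n=1}^{\infty}$ be a sequence of nonzero scalars in $\mathbb{K}$. Suppose that the unilateral weighted backward shift $T_\nu$, given by $$T_\nu(u_1,u_2,u_3,\cdots)=(v_2u_2,v_3u_3,v_4u_4,\cdots),$$ is a continuous linear operator on $X$ (in particular $T_\nu$ maps $X$ into $X$). Then $T_\nu$ is mixing if and only if $\lim_{n\to\infty}\left(\prod_{i=1}^{n}v_i\right)^{-1}e_n=0$ in $X$.
   Context: $\mathbb{K}$ is $\mathbb{R}$ or $\mathbb{C}$; $\mathbb{N}^{\ast}$ is the set of positive integers; $\mathbb{K}^{\mathbb{N}^{\ast}}$ is the vector space of all scalar sequences $(u_n)_{n=1}^{\infty}$. For $n\geq 1$, $e_n$ is the sequence whose $n$-th term is $1$ and all other terms are $0$. A topological vector space is a vector space over $\mathbb{K}$ with a topology making addition and scalar multiplication continuous (such a topology is called a vector topology). A topological sequence space is a topological vector space $X$ that is a linear subspace of $\mathbb{K}^{\mathbb{N}^{\ast}}$ and in which convergence implies coordinatewise convergence (convergence of nets, i.e. each coordinate functional $(u_k)_{k}\mapsto u_n$ is continuous on $X$). A subset $A$ of a vector space is convex if $sA+tA\subseteq A$ whenever $0\leq t\leq 1$, $s+t=1$; balanced if $tA\subseteq A$ for $|t|\leq 1$; absolutely convex if it is balanced and convex; absorbing if for every $x$ there is $\varepsilon>0$ with $tx\in A$ for $|t|<\varepsilon$.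 A barrel in a topological vector space is an absolutely convex absorbing closed set. A locally convex space is a topological vector space in which every neighborhood of $0$ contains a convex neighborhood of $0$. A barrelled space is a locally convex space in which every barrel is a neighborhood of $0$. A sequence $(\mu_n)_{n=1}^{\infty}$ in a topological vector space $X$ is a basis if every $\mu\in X$ has a unique representation $\mu=\sum_{n=1}^{\infty}\alpha_n\mu_n$ (convergence in $X$) with scalars $\alpha_n\in\mathbb{K}$. (In particular $e_n\in X$ for all $n$ when $(e_n)$ is a basis of $X$.) A continuous linear operator $S$ on a topological vector space $X$ is mixing if for any pair $U,V$ of nonempty open subsets of $X$ there is a nonnegative integer $N$ such that $S^n(U)\cap V\neq\emptyset$ for all $n\geq N$. *)

(* Defs.v *)
From HB Require Import structures.
From mathcomp Require Import all_boot all_order all_algebra.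
From mathcomp Require Import all_classical all_reals all_analysis.
From mathcomp Require Import complex.

Set Implicit Arguments.
Unset Strict Implicit.
Unset Printing Implicit Defensive.

Import Order.TTheory GRing.Theory Num.Theory.
Import numFieldNormedType.Exports.

Local Open Scope classical_set_scope.
Local Open Scope ring_scope.

Section LocallyConvex.
Variables (K : numFieldType) (X : topologicalLmodType K).

Definition balanced (A : set X) : Prop :=
  forall t : K, `|t| <= 1 -> [set t *: x | x in A] `<=` A.

Definition absolutely_convex (A : set X) : Prop := balanced A /\ convex_set A.

Definition absorbing (A : set X) : Prop :=
  forall x : X, exists2 eps : K, 0 < eps & forall t : K, `|t| < eps -> A (t *: x).

Definition barrel (A : set X) : Prop :=
  [/\ absolutely_convex A, absorbing A & closed A].

Definition locally_convex_space : Prop :=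
  forall U : set X, nbhs 0 U -> exists V, [/\ nbhs 0 V, convex_set V & V `<=` U].

Definition barrelled : Prop :=
  locally_convex_space /\ forall A : set X, barrel A -> nbhs 0 A.

Definition is_basis (mu : nat -> X) : Prop :=
  forall x : X, exists! a : nat -> K,
    series (fun n => a n *: mu n) @ \oo --> x.

Definition mixing (S : X -> X) : Prop :=
  forall U V : set X, open U -> open V -> U !=set0 -> V !=set0 ->
    exists N : nat, forall n : nat, (N <= n)%N ->
      (iter n S @` U) `&` V !=set0.

End LocallyConvex.

(* Sequences are indexed from 0: [u n] is the scalar written u_(n+1) when
   indexing starts at 1.  A linear subspace of K^nat is given by its inclusion
   map [terms], an injective linear map into the full space of sequences. *)
Record topSeqSpace (K : numFieldType) := TopSeqSpace {
  seq_sort :> topologicalLmodType K;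
  terms : {linear seq_sort -> (nat -> K^o)};
  terms_inj : injective terms;
  terms_continuous : forall n : nat,
    continuous (fun x : seq_sort => terms x n : K^o)
}.

Arguments terms {K} X : rename.

Definition unit_seq (K : numFieldType) (n : nat) : nat -> K^o :=
  fun k => (k == n)%:R.

Definition weighted_backward_shift (K : numFieldType) (v : nat -> K)
    (u : nat -> K^o) : nat -> K^o :=
  fun n => v n.+1 * u n.+1.

(* Main.v *)
Require Import Defs.
From HB Require Import structures.
From mathcomp Require Import all_boot all_order all_algebra.
From mathcomp Require Import all_classical all_reals all_analysis.
From mathcomp Require Import complex.

Set Implicit Arguments.
Unset Strict Implicit.
Unset Printing Implicit Defensive.

Import Order.TTheory GRing.Theory Num.Theory.
Import numFieldNormedType.Exports.

Local Open Scope classical_set_scope.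
Local Open Scope ring_scope.

(** Write [w n] for the product of the weights up to index [n] and
    [f n := (w n)^-1 *: e n].  The renormalisation turns the weighted shift into
    a plain backward shift along the [f n]: [T (f n.+1) = f n] and
    [T (f 0) = 0].

    If [f n] tends to [0], then moving a finite combination [y] of the [f k]
    forward by [n] steps gives a vector that tends to [0] and that the [n]-th
    iterate of [T] sends back to [y], while the same iterate kills any given
    finite combination [x] once [n] is large.  Hence [x] plus the displaced [y]
    is close to [x] and is mapped exactly onto [y].  Finite combinations are
    dense because [e] is a basis, so [T] is mixing
    ([mixing_of_backward_orbit]).

    Conversely, the coordinate projections [x |-> x_n e_n] tend to [0]
    pointwise, so for a closed absolutely convex neighbourhood [W] of [0] the
    vectors all of whose projections lie in [W] form a barrel, and therefore a
    neighbourhood of [0] ([equicontinuous_components]); this is the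
    Banach-Steinhaus argument.  If [T] is mixing, then for every large [n] that
    neighbourhood contains some [x] whose [n]-th iterate has a large leading
    coordinate.  That coordinate is [w n * x_n] up to the factor [v 0]
    ([head_iter_shift]), so [|w n * x_n| >= 1], and [f n] is [x_n e_n], which is
    in [W], times a scalar of modulus at most [1].  Thus [f n] is in [W]
    ([shift_mixing_necessary]). *)

(** * Closed absolutely convex neighbourhoods and mixing in topological modules *)

Section TopologicalModules.
Context {K : numFieldType} {X : topologicalLmodType K}.
Implicit Types (A U V W : set X) (x y : X).

Section Limits.
Context {I : Type} {F : set_system I} {FF : Filter F}.
Implicit Types (f g : I -> X).

Lemma tmod_cvgD f g x y :
  f @ F --> x -> g @ F --> y -> (fun i => f i + g i) @ F --> x + y.
Proof.
move=> fx gy.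
exact: (continuous2_cvg FF (h := fun a b : X => a + b) (add_continuous (x, y))).
Qed.

Lemma tmod_cvgZ (k : I -> K^o) (a : K^o) f x :
  k @ F --> a -> f @ F --> x -> (fun i => k i *: f i) @ F --> a *: x.
Proof.
move=> ka fx.
exact: (continuous2_cvg FF (h := fun (b : K^o) (z : X) => b *: z)
  (scale_continuous (a, x))).
Qed.

Lemma tmod_cvgZr (a : K) f x :
  f @ F --> x -> (fun i => a *: f i) @ F --> a *: x.
Proof. by apply: (@tmod_cvgZ (fun=> a)); exact: cvg_cst. Qed.

Lemma tmod_cvgB f g x y :
  f @ F --> x -> g @ F --> y -> (fun i => f i - g i) @ F --> x - y.
Proof.
move=> fx gy; apply: tmod_cvgD => //.
rewrite -scaleN1r (_ : (fun i => - g i) = fun i => -1 *: g i).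
  exact: tmod_cvgZr.
by apply: funext => i; rewrite scaleN1r.
Qed.

Lemma tmod_cvg_sum (J : Type) (s : seq J) (f : J -> I -> X) (l : J -> X) :
  (forall j, f j @ F --> l j) ->
  (fun i => \sum_(j <- s) f j i) @ F --> \sum_(j <- s) l j.
Proof.
move=> fl; elim: s => [|j s IH].
  rewrite big_nil (_ : (fun _ => _) = fun=> 0); first exact: cvg_cst.
  by apply: funext => i; rewrite big_nil.
rewrite big_cons (_ : (fun _ => _) = fun i => f j i + \sum_(k <- s) f k i).
  exact: tmod_cvgD.
by apply: funext => i; rewrite big_cons.
Qed.

End Limits.

Lemma convex_set_preimage (f : {linear X -> X}) A :
  convex_set A -> convex_set (f @^-1` A).
Proof.
move=> cA x y l; rewrite !inE /= => Ax Ay.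
have := cA (f x) (f y) l; rewrite !inE => /(_ Ax Ay).
by congr (A _); rewrite /conv /= linearD !linearZ.
Qed.

Lemma convex_set_bigcap (J : Type) (D : set J) (A : J -> set X) :
  (forall j, D j -> convex_set (A j)) -> convex_set (\bigcap_(j in D) A j).
Proof.
move=> cA x y l; rewrite !inE => Ax Ay j Dj.
by have := cA j Dj x y l; rewrite !inE; apply; [exact: Ax|exact: Ay].
Qed.

Lemma convex_set_closure A : convex_set A -> convex_set (closure A).
Proof.
move=> cA x y l; rewrite !inE => Ax Ay N.
have cvl : (fun z : X * X => l%:num *: z.1 + (1 - l%:num) *: z.2) @ (x, y)
    --> l%:num *: x + (1 - l%:num) *: y.
  by apply: tmod_cvgD; apply: tmod_cvgZr; [exact: cvg_fst|exact: cvg_snd].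
move=> /cvl [[/= P Q] [Px Qy] PQ].
have [a [Aa Pa]] := Ax P Px; have [b [Ab Qb]] := Ay Q Qy.
exists (l%:num *: a + (1 - l%:num) *: b); split; last exact: (PQ (a, b)).
by have := cA a b l; rewrite !inE; apply.
Qed.

Lemma balanced_closure A : balanced A -> balanced (closure A).
Proof.
move=> bA t t1 _ [x Ax <-] N.
have tx : (fun y => t *: y) @ x --> t *: x by apply: tmod_cvgZr; exact: cvg_id.
move=> /tx/Ax[a [Aa Na]].
by exists (t *: a); split => //; apply: (bA t t1); exists a.
Qed.

(** The largest balanced subset of [A].  Being an intersection of preimages
    under scalings, it inherits convexity from [A]. *)
Definition balanced_core A : set X :=
  \bigcap_(t in [set t : K | `|t| <= 1]) ( *:%R t @^-1` A).

Lemma balanced_core_balanced A : balanced (balanced_core A).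
Proof.
move=> t t1 _ [x Ax <-] s s1; rewrite /preimage /= scalerA.
by apply: Ax => /=; rewrite normrM mulr_ile1.
Qed.

(** Scalar multiplication is jointly continuous at [(0, 0)], so there are a
    radius [d] and a neighbourhood [Q] of [0] with [t *: Q] inside [U] for all
    [`|t| < d]; the core then contains [(d / 2) *: Q]. *)
Lemma nbhs_balanced_core U : nbhs 0 U -> nbhs 0 (balanced_core U).
Proof.
move=> U0; have := @scale_continuous K X (0, 0) U; rewrite /= scaler0.
move=> /(_ U0) [[/= P Q] [/nbhs_ballP [d /= d0 dP] Q0] PQ].
have d20 : d / 2 != 0 by rewrite gt_eqF// divr_gt0.
have nQ : \forall x \near (0 : X), Q ((d / 2)^-1 *: x).
  have cv0 : (fun x : X => (d / 2)^-1 *: x) @ (0 : X) --> (d / 2)^-1 *: (0 : X).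
    by apply: tmod_cvgZr; exact: cvg_id.
  by apply: cv0; rewrite scaler0.
apply: filterS nQ => x Qx t /= t1.
rewrite /preimage /= -[x](scalerKV d20) scalerA.
apply: (PQ (t * (d / 2), (d / 2)^-1 *: x)); split => //=.
apply: dP; rewrite /ball /= sub0r normrN normrM.
rewrite (ger0_norm (ltW (divr_gt0 d0 (ltr0Sn _ _)))).
apply: (@le_lt_trans _ _ (d / 2)); last first.
  by rewrite ltr_pdivrMr// ltr_pMr// ltr1n.
by rewrite ler_piMl// ltW// divr_gt0.
Qed.

(** A limit point of [W] is a point of [W] up to an error that can also be
    taken in [W]. *)
Lemma closure_sub_of_add W U :
  balanced W -> nbhs 0 W -> (forall x y, W x -> W y -> U (x + y)) ->
  closure W `<=` U.
Proof.
move=> bW W0 WU x clx.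
have xW : nbhs x [set y | W (x - y)].
  have cv0 : (fun y => x - y) @ x --> x - x.
    by apply: tmod_cvgB; [exact: cvg_cst|exact: cvg_id].
  by apply: cv0; rewrite subrr.
have [y [Wy Wxy]] := clx _ xW.
by rewrite -(subrKC y x); exact: WU.
Qed.

(** Local convexity only provides convex neighbourhoods.  The balanced core
    makes one of them balanced, and starting from [V] with [V + V] inside [U]
    leaves room to take the closure. *)
Lemma closed_absolutely_convex_nbhs U :
  locally_convex_space X -> nbhs 0 U ->
  exists W, [/\ nbhs 0 W, absolutely_convex W, closed W & W `<=` U].
Proof.
move=> lcX U0.
have := @add_continuous X (0, 0) U; rewrite /= addr0.
move=> /(_ U0) [[/= P Q] [P0 Q0] PQ].
have [V [V0 cV VPQ]] := lcX _ (filterI P0 Q0).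
exists (closure (balanced_core V)); split.
- exact: (filterS (@subset_closure _ _) (nbhs_balanced_core V0)).
- split; first exact: (balanced_closure (@balanced_core_balanced V)).
  apply: convex_set_closure; apply: convex_set_bigcap => t _.
  exact: convex_set_preimage.
- exact: closed_closure.
- apply: closure_sub_of_add.
  + exact: balanced_core_balanced.
  + exact: nbhs_balanced_core.
  + have core_sub x : balanced_core V x -> V x.
      by move=> /(_ 1); rewrite /preimage /= scale1r; apply; rewrite normr1.
    move=> x y /core_sub/VPQ[Px _] /core_sub/VPQ[_ Qy].
    exact: (PQ (x, y)).
Qed.

(** A sequence tending to [0] is bounded: its tail already lies in [W], and each
    of the remaining finitely many terms is absorbed by [W]. *)
Lemma null_seq_absorbed (u : nat -> X) W :
  balanced W -> nbhs 0 W -> u @ \oo --> (0 : X) ->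
  exists2 d : K, 0 < d & forall t n, `|t| < d -> W (t *: u n).
Proof.
move=> bW W0 u0.
have absorb x : exists2 d : K, 0 < d & forall t, `|t| < d -> W (t *: x).
  have cv0 : (fun t : K^o => t *: x) @ (0 : K^o) --> 0 *: x.
    apply: (tmod_cvgZ (FF := nbhs_filter (0 : K^o))); first exact: cvg_id.
    exact: cvg_cst.
  have /nbhs_ballP[] : nbhs (0 : K^o) [set t | W (t *: x)].
    by apply: cv0; rewrite scale0r.
  move=> d /= d0 dW.
  by exists d => // t td; apply: dW; rewrite /ball /= sub0r normrN.
have [N _ NW] := u0 _ W0.
have {absorb} [d d0 dW] : exists2 d : K, 0 < d &
    forall t n, (n < N)%N -> `|t| < d -> W (t *: u n).
  elim: {NW}N => [|N [d d0 dW]]; first by exists 1.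
  have [c c0 cW] := absorb (u N).
  exists (Num.min d c).
    by rewrite /Num.min; case: ifP.
  move=> t n; rewrite ltnS leq_eqVlt => nN tdc.
  have dc : d >=< c by rewrite real_comparable// gtr0_real.
  have [td tc] : `|t| < d /\ `|t| < c.
    by apply/andP; rewrite -comparable_lt_min.
  by case/orP: nN => [/eqP ->|nN]; [exact: cW|exact: dW].
exists (Num.min d 1); first by rewrite /Num.min; case: ifP.
move=> t n tdc.
have dc : d >=< 1 by rewrite real_comparable// gtr0_real.
have [td t1] : `|t| < d /\ `|t| < 1.
  by apply/andP; rewrite -comparable_lt_min.
have [nN|Nn] := ltnP n N; first exact: dW.
apply: (bW t); first exact: ltW.
by exists (u n) => //; exact: NW.
Qed.

Lemma mixing_nbhs (S : X -> X) x y U V :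
  mixing S -> nbhs x U -> nbhs y V ->
  \forall n \near \oo, exists2 z, U z & V (iter n S z).
Proof.
move=> mS xU yV.
have [N NS] := mS _ _ (@open_interior _ U) (@open_interior _ V)
  (ex_intro _ x xU) (ex_intro _ y yV).
exists N => // n /= /NS[_ [[z Uz <-] Vz]].
by exists z; exact: interior_subset.
Qed.

Lemma iter_linear_sum (S : {linear X -> X}) n (J : Type) (s : seq J)
    (a : J -> K) (f : J -> X) :
  iter n S (\sum_(j <- s) a j *: f j) = \sum_(j <- s) a j *: iter n S (f j).
Proof.
elim: n => [//|n IH] /=; rewrite IH linear_sum.
by apply: eq_bigr => j _; rewrite linearZ.
Qed.

Lemma iter_linearD (S : {linear X -> X}) n x y :
  iter n S (x + y) = iter n S x + iter n S y.
Proof. by elim: n => [//|n IH] /=; rewrite IH linearD. Qed.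

(** An instance of Kitai's criterion: [f k |-> f k.+1] acts as a
    right inverse of [S] on finite combinations of the [f k], its iterates tend
    to [0] there, and those of [S] eventually vanish there. *)
Lemma mixing_of_backward_orbit (S : {linear X -> X}) (f : nat -> X) :
  S (f 0%N) = 0 -> (forall n, S (f n.+1) = f n) -> f @ \oo --> (0 : X) ->
  (forall x, exists a : nat -> K, series (fun n => a n *: f n) @ \oo --> x) ->
  mixing S.
Proof.
move=> Sf0 SfS f0 fdense.
have approx U : open U -> U !=set0 ->
    exists m (a : nat -> K), U (\sum_(0 <= k < m) a k *: f k).
  move=> oU [x Ux]; have [a /(_ U)] := fdense x.
  by case=> [|m _ /(_ m (leqnn m)) am]; [exact: open_nbhs_nbhs|exists m, a].
have iter_back n k : iter n S (f (k + n)%N) = f k.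
  by elim: n => [|n IH]; rewrite ?addn0// iterSr addnS SfS.
have iter0 n : iter n S 0 = 0.
  by elim: n => [//|n /= ->]; rewrite linear0.
have iter_kill n k : (k < n)%N -> iter n S (f k) = 0.
  move=> kn; have := iter_back k 0%N; rewrite add0n => fk.
  by rewrite -(subnK kn) iterD iterS fk Sf0 iter0.
move=> U V oU oV /(approx _ oU)[m [a Ua]] /(approx _ oV)[p [b Vb]].
set x := (\sum_(_ <= _ < _) _) in Ua.
have z0 : (fun n => x + \sum_(0 <= k < p) b k *: f (k + n)%N) @ \oo --> x.
  rewrite [X in _ --> X](_ : _ = x + \sum_(0 <= k < p) b k *: (0 : X)); last first.
    by rewrite big1 ?addr0// => k _; rewrite scaler0.
  apply: tmod_cvgD; first exact: cvg_cst.
  apply: (@tmod_cvg_sum _ _ _ _ _ (fun k n => b k *: f (k + n)%N)) => k.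
  by apply: tmod_cvgZr; apply: cvg_comp f0; exact: cvg_addnl.
have [N _ NU] := z0 U (open_nbhs_nbhs (conj oU Ua)).
exists (maxn N m) => n; rewrite geq_max => /andP[Nn mn].
exists (\sum_(0 <= k < p) b k *: f k); split=> //.
exists (x + \sum_(0 <= k < p) b k *: f (k + n)%N); first exact: NU.
(* Each term of [x] has index below [m <= n], so [n] iterations kill it. *)
rewrite iter_linearD !iter_linear_sum big_nat big1 ?add0r; last first.
  by move=> k /andP[_ km]; rewrite iter_kill ?scaler0// (leq_trans km).
by apply: eq_bigr => k _; rewrite iter_back.
Qed.

End TopologicalModules.

(** * Coordinate projections of a unit vector basis *)

Lemma termsZ (K : numFieldType) (X : topSeqSpace K) (a : K) (x : X) n :
  terms X (a *: x) n = a * terms X x n.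
Proof. by rewrite linearZ. Qed.

Section UnitVectorBasis.
Context {K : numFieldType} {X : topSeqSpace K} {e : nat -> X}.
Hypothesis he : forall n, terms X (e n) = unit_seq K n.
Hypothesis hbasis : is_basis e.

Lemma terms_unit n k : terms X (e n) k = (k == n)%:R.
Proof. by rewrite he. Qed.

(** Continuity of the coordinates forces the coefficients of the basis
    expansion of [x] to be its terms. *)
Lemma basis_expansion (x : X) :
  series (fun n => terms X x n *: e n) @ \oo --> x.
Proof.
have [a [ax _]] := hbasis x.
suff -> : terms X x = a by [].
apply: funext => k.
have := @terms_continuous K X k x.
move=> /(cvg_comp _ _ ax) xk.
apply/esym; apply: (cvg_unique (@norm_hausdorff _ K^o) _ xk).
apply: cvg_near_cst; exists k.+1 => // n /= kn.
rewrite /series /= linear_sum fct_sumE.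
rewrite (bigD1_seq k) ?mem_index_iota ?iota_uniq//=.
rewrite big1 ?addr0 => [|i ik]; last first.
  by rewrite termsZ terms_unit eq_sym (negbTE ik) mulr0.
by rewrite termsZ terms_unit eqxx mulr1.
Qed.

Definition component n (x : X) : X := terms X x n *: e n.

Lemma component_is_linear n : linear (component n).
Proof.
by move=> a x y; rewrite /component linearP scalerDl scalerA.
Qed.

HB.instance Definition _ n :=
  GRing.isLinear.Build K X X *:%R (component n) (component_is_linear n).

Lemma continuous_component n : continuous (component n).
Proof.
move=> x; apply: (@tmod_cvgZ _ _ _ (nbhs x) (nbhs_filter _) (fun y => terms X y n)).
  exact: terms_continuous.
exact: cvg_cst.
Qed.

(** [component n x] is the difference of two consecutive partial sums of the
    expansion of [x]. *)
Lemma cvg_component (x : X) : (fun n => component n x) @ \oo --> (0 : X).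
Proof.
have sx := @basis_expansion x.
have sx1 := (cvg_comp _ _ (cvg_addnl 1) sx).
rewrite -(subrr x).
suff -> : component ^~ x = (fun n => series (fun k => component k x) (1 + n)%N
  - series (fun k => component k x) n); first exact: (tmod_cvgB sx1 sx).
by apply: funext => n; rewrite add1n seriesSB.
Qed.

(** Banach-Steinhaus for the coordinate projections: the intersection of the
    preimages of [W] is a barrel.  It is absorbing because the sequence of
    projections of a vector tends to [0], hence is bounded. *)
Lemma equicontinuous_components (W : set X) : barrelled X ->
  absolutely_convex W -> nbhs 0 W -> closed W ->
  \forall x \near 0, forall n, W (component n x).
Proof.
move=> [_ barX] [bW cW] W0 clW.
suff : barrel (\bigcap_(n in setT) (component n @^-1` W)).
  by move=> /barX; apply: filterS => x Wx n; exact: Wx.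
split; first split.
- move=> t t1 _ [x Wx <-] n _; rewrite /preimage /= linearZ.
  by apply: (bW t t1); exists (component n x) => //; exact: Wx.
- apply: convex_set_bigcap => n _.
  exact: (convex_set_preimage (f := component n)).
- move=> x; have [d d0 dW] := null_seq_absorbed bW W0 (@cvg_component x).
  by exists d => // t td n _; rewrite /preimage /= linearZ; exact: dW.
- apply: closed_bigI => n _.
  by have /continuous_closedP := @continuous_component n; exact.
Qed.

End UnitVectorBasis.

(** * The weighted backward shift *)

Section WeightedShift.
Context {K : numFieldType} {X : topSeqSpace K} {e : nat -> X}.
Hypothesis he : forall n, terms X (e n) = unit_seq K n.
Variables (v : nat -> K) (T : {linear X -> X}).
Hypothesis hv : forall n, v n != 0.
Hypothesis hT : forall x, terms X (T x) = weighted_backward_shift v (terms X x).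

Let w n := \prod_(0 <= i < n.+1) v i.

Lemma weight_prod_neq0 n : w n != 0.
Proof. by rewrite prodf_seq_neq0; apply/allP => i _; rewrite hv. Qed.

Lemma shift_unit0 : T (e 0%N) = 0.
Proof.
apply: (@terms_inj K X); rewrite hT linear0; apply: funext => k.
by rewrite /weighted_backward_shift (terms_unit he) mulr0.
Qed.

Lemma shift_unitS n : T (e n.+1) = v n.+1 *: e n.
Proof.
apply: (@terms_inj K X); rewrite hT; apply: funext => k.
rewrite /weighted_backward_shift [RHS]termsZ !(terms_unit he) eqSS.
by have [->|] := eqVneq k n; rewrite ?mulr0.
Qed.

(** The shift contributes the weights from [v 1] to [v n]; the factor [v 0]
    completes their product to [w n]. *)
Lemma head_iter_shift n x :
  v 0%N * terms X (iter n T x) 0%N = w n * terms X x n.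
Proof.
(* The shift satisfies [w k * (T y)_k = w k.+1 * y_(k.+1)]. *)
suff H k : w k * terms X (iter n T x) k = w (n + k)%N * terms X x (n + k)%N.
  by have := H 0%N; rewrite addn0 {1}/w big_nat1.
elim: n k => [//|n IH] k; rewrite iterS hT /weighted_backward_shift.
rewrite addSn -addnS -IH mulrA; congr (_ * _).
by rewrite /w [in RHS]big_nat_recr.
Qed.

Lemma shift_mixing_sufficient : is_basis e ->
  (fun n => (w n)^-1 *: e n) @ \oo --> (0 : X) -> mixing T.
Proof.
move=> hbasis f0; apply: (mixing_of_backward_orbit _ _ f0).
- by rewrite linearZ /= shift_unit0 scaler0.
- move=> n; rewrite linearZ /= shift_unitS scalerA; congr (_ *: _).
  by rewrite /w [in LHS]big_nat_recr//= invfM mulrVK ?unitfE.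
move=> x; exists (fun n => terms X x n * w n).
rewrite (_ : (fun n => _) = fun n => terms X x n *: e n).
  exact: basis_expansion.
by apply: funext => n; rewrite scalerA mulfK// weight_prod_neq0.
Qed.

(** Mixing produces small vectors [x] for which [w n * x_n] stays within
    distance [1] of [2]; since all components of [x] are small, so is
    [(w n)^-1 *: e n]. *)
Lemma shift_mixing_necessary : is_basis e -> barrelled X ->
  mixing T -> (fun n => (w n)^-1 *: e n) @ \oo --> (0 : X).
Proof.
move=> hbasis bX mT U U0.
have [W [W0 acW clW WU]] := closed_absolutely_convex_nbhs bX.1 U0.
have eqc := equicontinuous_components he hbasis bX acW W0 clW.
have [x0 hx0] : exists x0 : X, v 0%N * terms X x0 0%N = 2.
  exists ((2 / v 0%N) *: e 0%N).
  by rewrite termsZ (terms_unit he) eqxx mulr1 mulrCA divff// mulr1.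
have head : nbhs x0 [set y : X | `|2 - v 0%N * terms X y 0%N| < 1].
  have hc : (fun y : X => v 0%N * terms X y 0%N : K^o) @ x0
      --> (v 0%N * terms X x0 0%N : K^o).
    exact: (@tmod_cvgZr K K^o _ _ _ (v 0%N) (fun y => terms X y 0%N) _
      (@terms_continuous K X 0%N _)).
  rewrite hx0 in hc.
  exact: (hc _ (nbhsx_ballx (2 : K^o) 1 ltr01)).
apply: filterS (mixing_nbhs mT eqc head) => n [x Wx /=].
rewrite head_iter_shift => near2; apply: WU.
have big : 1 <= `|w n * terms X x n|.
  have := lerB_normD 2 (w n * terms X x n - 2).
  rewrite subrKC normr_nat distrC => /(le_trans _); apply.
  by rewrite lerBrDr -lerBrDl (_ : 2 - 1 = 1) ?ltW// addrK.
have wx0 : w n * terms X x n != 0.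
  by apply: contraTneq big => ->; rewrite normr0 ler10.
(* [(w n)^-1 *: e n] is the component [x_n *: e n] of [x], which lies in [W],
   divided by [w n * x_n]. *)
apply: (acW.1 (w n * terms X x n)^-1); first by rewrite normfV invf_le1 ?normr_gt0.
exists (component (e := e) n x); first exact: Wx.
rewrite /component scalerA invfM -mulrA mulVf ?mulr1//.
by move: wx0; rewrite mulf_eq0 negb_or => /andP[].
Qed.

End WeightedShift.

Theorem theorem1p4 (R : realType) (K : numFieldType)
    (hK : K = (R : numFieldType) \/ K = (R[i]%C : numFieldType))
    (X : topSeqSpace K) (hX : barrelled X)
    (e : nat -> X) (he : forall n, terms X (e n) = unit_seq K n)
    (hbasis : is_basis e)
    (v : nat -> K) (hv : forall n, v n != 0)
    (T : {linear X -> X})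
    (hT : forall x, terms X (T x) = weighted_backward_shift v (terms X x))
    (hTc : continuous T) :
  mixing T <->
  (fun n => (\prod_(0 <= i < n.+1) v i)^-1 *: e n) @ \oo --> (0 : X).
Proof.
split; first exact: shift_mixing_necessary.
exact: shift_mixing_sufficient.
Qed.
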